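(* Let $J,R,Q\in\mathbb{C}^{n,n}$ with $J^*=-J$, $R^*=R\ge 0$, $Q^*=Q>0$, let $\omega\in\mathbb{R}$, and put $P:=Q^{-1}(i\omega I_n-JQ)^*(i\omega I_n-JQ)Q^{-1}$. Let $\mathcal{K}=(R^2,R,P)$, let $W(\mathcal{K})=\{\rho_{\mathcal{K}}(x): x\in\mathbb{C}^n,\ \|x\|=1\}\subset\mathbb{R}^3$ with $\rho_{\mathcal{K}}(x)=[x^*R^2x,\ x^*Rx,\ x^*Px]^T$, and let $h(z)=\left(\frac{z_1}{z_2}\right)^2+z_3$. Suppose that $z_\star$ is a local minimizer of $h$ in $W(\mathcal{K})$ and that $h$ is differentiable at $z_\star$. Then $$\min_{z\in W(\mathcal{K})}\nabla h(z_\star)^Tz=\nabla h(z_\star)^Tz_\star.\qquad( * )$$ Moreover, $( * )$ holds if and only if $z_\star=\rho_{\mathcal{K}}(x_\star)$ for an $x_\star\in\mathbb{C}^n$ with $\|x_\star\|=1$ satisfying the eigenvector-dependent nonlinear eigenvalue problem $$H(x)x=\mu x,$$ where $H(x)\in\mathbb{C}^{n,n}$ is the Hermitian matrix $$H(x):=2\,\frac{x^*R^2x}{(x^*Rx)^2}\,R^2-2\,\frac{(x^*R^2x)^2}{(x^*Rx)^3}\,R+P$$ and $\mu$ is the smallest eigenvalue of $H(x)$.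
   Context: $\|\cdot\|$ is the Euclidean norm; $A\ge 0$, $A>0$ mean that $A$ is Hermitian and positive semidefinite, positive definite, respectively. The set $W(\mathcal{K})$ is the joint numerical range of the Hermitian matrices $R^2,R,P$. In $h$ the fraction $\frac{z_1}{z_2}$ is defined to be $0$ when $z_1=z_2=0$ (on $W(\mathcal{K})$, $z_2=0$ forces $z_1=0$); $h$ is regarded as differentiable at a point $z\in W(\mathcal{K})$ if and only if $z_2\neq 0$. *)

(* Defs.v *)
From HB Require Import structures.
From mathcomp Require Import all_boot all_order all_algebra.
From mathcomp Require Import all_classical all_reals all_analysis.
From mathcomp Require Import complex.

Set Implicit Arguments.
Unset Strict Implicit.
Unset Printing Implicit Defensive.

Import Order.TTheory GRing.Theory Num.Theory.
Import numFieldNormedType.Exports.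

Local Open Scope classical_set_scope.
Local Open Scope ring_scope.
Local Open Scope sesquilinear_scope.

Section ComplexMatrices.
Variables (K : realType) (n : nat).
Implicit Types (A : 'M[K[i]]_n) (x : 'cV[K[i]]_n).

Definition enorm x : K := Num.sqrt (\sum_(k < n) Normc.normc (x k 0) ^+ 2).

Definition qform A x : K[i] := (x^t* *m A *m x) 0 0.

(* In the order of K[i], 0 <= c and 0 < c entail that c is real. *)
Definition psdmx A : Prop := A^t* = A /\ forall x, 0 <= qform A x.

Definition pdmx A : Prop := A^t* = A /\ forall x, x != 0 -> 0 < qform A x.

(* The order of K[i] only compares numbers with the same imaginary part, so
   mu <= nu for every eigenvalue nu is the usual order on a real spectrum.
   Mathcomp's eigenvalue refers to row vectors, which have the same spectrum. *)
Definition smallest_eigenvalue A (mu : K[i]) : Prop :=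
  eigenvalue A mu /\ forall nu : K[i], eigenvalue A nu -> mu <= nu.

Definition Pmx (J Q : 'M[K[i]]_n) (omega : K) : 'M[K[i]]_n :=
  let M := ('i%C * omega%:C%C)%:M - J *m Q in
  invmx Q *m M^t* *m M *m invmx Q.

(* The forms below are real when R and P are Hermitian, so Re loses nothing. *)
Definition rho (R P : 'M[K[i]]_n) x : 'cV[K]_3 :=
  \col_(k < 3) [:: complex.Re (qform (R *m R) x);
                   complex.Re (qform R x);
                   complex.Re (qform P x)]`_k.

Definition joint_range (R P : 'M[K[i]]_n) : set 'cV[K]_3 :=
  [set z | exists x, enorm x = 1 /\ z = rho R P x].

Definition Hmx (R P : 'M[K[i]]_n) x : 'M[K[i]]_n :=
  let q1 := qform (R *m R) x in
  let q2 := qform R x in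
  (2 * (q1 / q2 ^+ 2)) *: (R *m R) - (2 * (q1 ^+ 2 / q2 ^+ 3)) *: R + P.

End ComplexMatrices.

Section Objective.
Variable K : realType.
Implicit Types z : 'cV[K]_3.

(* The indices 0, 1, 2 : 'I_3 stand for 1, 2, 3; and 0 / 0 = 0 in mathcomp. *)
Definition hfun z : K := (z 0 0 / z 1 0) ^+ 2 + z 2 0.

(* On the joint numerical range, h counts as differentiable at z exactly when
   z_2 != 0; there gradient, made of partial derivatives, is the usual one. *)
Definition hdiff z : Prop := z 1 0 != 0.

Definition gradient (f : 'cV[K]_3 -> K) z : 'cV[K]_3 :=
  \col_(k < 3) 'D_(delta_mx k 0) f z.

Definition inner (u v : 'cV[K]_3) : K := (u^T *m v) 0 0.

Definition local_minimizer (f : 'cV[K]_3 -> K) (W : set 'cV[K]_3) z : Prop :=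
  W z /\ \forall w \near z, W w -> f z <= f w.

Definition is_min (S : set K) (m : K) : Prop := S m /\ lbound S m.

End Objective.

(* Main.v *)
(** Let z = rho x be a local minimizer with ||x|| = 1, put c := z_1 / z_2,
    A := R^2 - c R and B := H(x) - z_3 I = (2 c / z_2) A + P - z_3 I, so that
    x^*Ax = x^*Bx = 0. If y^*By < 0 for some y, multiply y by a complex scalar
    so that Re (x^*Ay) = 0 and Re (x^*By) <= 0. Along x + t y the ratio z_1/z_2
    is then c + O(t^2), and the quotient (h - h(z)) / t^2 is at most
    2 c y^*Ay / z_2(t) + t^2 (y^*Ay)^2 / z_2(t)^2
      + (y^*By - 2 c y^*Ay / z_2) / ||x + t y||^2,
    whose limit at t = 0+ is y^*By < 0, a contradiction. Hence H(x) >= z_3 I,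
    which is the linearized inequality; the convexity of the joint numerical
    range is not needed. Since the linearized objective at rho y is y^*H(x)y,
    the equivalence is the variational characterization of the smallest
    eigenvalue. *)

Require Import Defs.
From HB Require Import structures.
From mathcomp Require Import all_boot all_order all_algebra.
From mathcomp Require Import all_classical all_reals all_analysis.
From mathcomp Require Import complex.
From mathcomp Require Import ring lra.

Set Implicit Arguments.
Unset Strict Implicit.
Unset Printing Implicit Defensive.

Import Order.TTheory GRing.Theory Num.Theory.
Import numFieldNormedType.Exports.

Local Open Scope classical_set_scope.
Local Open Scope ring_scope.
Local Open Scope sesquilinear_scope.

(** * Sesquilinear and quadratic forms of Hermitian matrices *)

Section HermitianForms.
Variables (K : realType) (n : nat).
Implicit Types (A B : 'M[K[i]]_n) (x y : 'cV[K[i]]_n) (a : K) (u : K[i]).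

Definition sform A x y : K[i] := (x^t* *m A *m y) 0 0.

(** Taken in [K], so that orders and limits are those of the reals; for Hermitian [A] nothing is
    lost ([qform_real]). *)
Definition rform A x : K := complex.Re (qform A x).

Lemma adjmxM (m p q : nat) (A : 'M[K[i]]_(m, p)) (B : 'M[K[i]]_(p, q)) :
  (A *m B)^t* = B^t* *m A^t*.
Proof. by rewrite trmx_mul map_mxM. Qed.

Lemma adjmxZ (m p : nat) u (A : 'M[K[i]]_(m, p)) :
  (u *: A)^t* = conjc u *: A^t*.
Proof. by apply/matrixP => i j; rewrite !mxE rmorphM. Qed.

Lemma adjmxD (m p : nat) (A B : 'M[K[i]]_(m, p)) : (A + B)^t* = A^t* + B^t*.
Proof. by apply/matrixP => i j; rewrite !mxE rmorphD. Qed.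

Lemma adjmx_scalar u : (u%:M : 'M[K[i]]_n)^t* = (conjc u)%:M.
Proof. by rewrite tr_scalar_mx map_scalar_mx. Qed.

Lemma adjmx1 : (1%:M : 'M[K[i]]_n)^t* = 1%:M.
Proof. by rewrite adjmx_scalar rmorph1. Qed.

Lemma ReD u v : complex.Re (u + v : K[i]) = complex.Re u + complex.Re v.
Proof. by case: u v => ? ? [? ?]. Qed.

Lemma Re_mulr a u : complex.Re (a%:C%C * u) = a * complex.Re u.
Proof. by case: u => u1 u2 /=; rewrite mul0r subr0. Qed.

Lemma normc2E u : Normc.normc u ^+ 2 = complex.Re (conjc u * u).
Proof.
case: u => a b /=; rewrite sqr_sqrtr ?addr_ge0 ?sqr_ge0 //.
by rewrite mulNr opprK !expr2.
Qed.

Lemma conjcM_gt0 u : u != 0 -> 0 < complex.Re (conjc u * u).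
Proof.
move=> u0; rewrite -normc2E exprn_even_gt0 //=.
by apply: contra_neq u0 => /Normc.eq0_normc.
Qed.

Lemma sform_conj A x y : A^t* = A -> sform A y x = conjc (sform A x y).
Proof.
move=> hA; rewrite /sform -[in LHS]hA.
have -> : y^t* *m A^t* *m x = (x^t* *m A *m y)^t*.
  by rewrite !adjmxM trmxCK mulmxA.
by rewrite !mxE.
Qed.

Lemma qform_real A x : A^t* = A -> qform A x = (rform A x)%:C%C.
Proof.
move=> /(@sform_conj A x x); rewrite /sform -/(qform A x) /rform.
by case: (qform A x) => a b /= [/eqP]; rewrite -addr_eq0 -mulr2n mulrn_eq0 /= => /eqP ->.
Qed.

Lemma sformZr A u x y : sform A x (u *: y) = u * sform A x y.
Proof. by rewrite /sform -scalemxAr mxE. Qed.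

Lemma rformZ A u x : rform A (u *: x) = complex.Re (conjc u * u) * rform A x.
Proof.
rewrite /rform /qform adjmxZ -!scalemxAl -scalemxAr scalerA mxE.
have -> : conjc u * u = (complex.Re (conjc u * u))%:C%C.
  by case: u => a b; apply/eqP; rewrite eq_complex /= eqxx /= mulrC mulNr addrN.
by rewrite Re_mulr.
Qed.

Lemma rformZr A a x : rform A (a%:C%C *: x) = a ^+ 2 * rform A x.
Proof. by rewrite rformZ /= oppr0 !mulr0 subr0 expr2. Qed.

Lemma rformDl A B x : rform (A + B) x = rform A x + rform B x.
Proof. by rewrite /rform /qform mulmxDr mulmxDl mxE ReD. Qed.

Lemma rformZl A a x : rform (a%:C%C *: A) x = a * rform A x.
Proof. by rewrite /rform /qform -scalemxAr -scalemxAl mxE Re_mulr. Qed.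

(** As [A] is Hermitian, the two cross terms are conjugate to each other, and their sum is twice a
    real part. *)
Lemma rformDr A t x y : A^t* = A -> rform A (x + t%:C%C *: y) =
  rform A x + t * (2 * complex.Re (sform A x y)) + t ^+ 2 * rform A y.
Proof.
move=> hA; rewrite -rformZr; set y' := _ *: y.
have -> : t * (2 * complex.Re (sform A x y)) = 2 * complex.Re (sform A x y').
  by rewrite sformZr Re_mulr; ring.
have -> : rform A (x + y') =
    complex.Re (sform A x x + sform A y' x + (sform A x y' + sform A y' y')).
  by rewrite /rform /qform /sform adjmxD !(mulmxDl, mulmxDr) !mxE.
rewrite (sform_conj x y' hA) !ReD /rform /qform -/(sform A x x) -/(sform A y' y').
by case: (sform A x y') => c d /=; ring.
Qed.

Lemma rform1E x : rform 1%:M x = \sum_(k < n) Normc.normc (x k 0) ^+ 2.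
Proof.
rewrite /rform /qform mulmx1 mxE.
transitivity (\sum_(k < n) complex.Re ((x^t* 0 k) * x k 0)).
  by elim/big_ind2: _ => //= a b c d <- <-; rewrite ReD.
by apply: eq_bigr => k _; rewrite !mxE normc2E.
Qed.

Lemma enorm_sqr x : enorm x ^+ 2 = rform 1%:M x.
Proof. by rewrite rform1E sqr_sqrtr // sumr_ge0 // => k _; rewrite sqr_ge0. Qed.

Lemma enorm_eq1 x : (enorm x = 1) <-> (rform 1%:M x = 1).
Proof.
split=> [h|h]; first by rewrite -enorm_sqr h expr1n.
by rewrite /enorm -rform1E h sqrtr1.
Qed.

Lemma rform1_gt0 x : x != 0 -> 0 < rform 1%:M x.
Proof.
move=> x0; rewrite rform1E lt_def sumr_ge0 ?andbT; last by move=> k _; rewrite sqr_ge0.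
apply: contra_neq x0 => /psumr_eq0P h; apply/matrixP => k j.
rewrite ord1 mxE; apply: Normc.eq0_normc.
by apply/eqP; rewrite -sqrf_eq0 h // => i _; rewrite sqr_ge0.
Qed.

(** One scalar serves all [A] at once: dividing several forms by the same squared norm amounts to
    normalizing the vector. *)
Lemma exists_unit_multiple x : x != 0 ->
  exists a, enorm (a%:C%C *: x) = 1 /\
    forall A, rform A (a%:C%C *: x) = rform A x / rform 1%:M x.
Proof.
move=> /rform1_gt0 h; have s0 := ltW h.
exists (Num.sqrt (rform 1%:M x))^-1.
have e A : rform A (((Num.sqrt (rform 1%:M x))^-1)%:C%C *: x) =
    rform A x / rform 1%:M x.
  by rewrite rformZr exprVn sqr_sqrtr // mulrC.
by split=> //; apply/enorm_eq1; rewrite e divff // gt_eqF.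
Qed.

End HermitianForms.

(** * Rayleigh quotients and the smallest eigenvalue *)

Lemma quadratic_ge0 (K : realFieldType) (s r : K) : 0 <= r ->
  (forall t, 0 <= t * (2 * s) + t ^+ 2 * r) -> s = 0.
Proof.
(* The vertex would be at - s / r, but [r] may be 0; with r + 1 the value is still a negative
   multiple of s ^ 2. *)
move=> r0 /(_ (- s / (r + 1))); have r1 : 0 < r + 1 by rewrite ltr_wpDl.
rewrite -(pmulr_rge0 _ (exprn_gt0 2 r1)).
have -> : (r + 1) ^+ 2 * (- s / (r + 1) * (2 * s) + (- s / (r + 1)) ^+ 2 * r)
    = - (s ^+ 2 * (r + 2)) by field; rewrite gt_eqF.
rewrite oppr_ge0 pmulr_lle0 ?ltr_wpDl // => h.
by apply/eqP; rewrite -sqrf_eq0 eq_le h sqr_ge0.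
Qed.

Section RayleighQuotient.
Variables (K : realType) (n : nat) (A : 'M[K[i]]_n) (hA : A^t* = A).
Implicit Types (x y : 'cV[K[i]]_n).

(** For a row eigenvector v, v A v^* = nu v v^*, so nu is the Rayleigh quotient of the column v^*
    and in particular real. *)
Lemma eigenvalue_rform (nu : K[i]) : eigenvalue A nu ->
  exists2 y, enorm y = 1 & nu = (rform A y)%:C%C.
Proof.
move=> /eigenvalueP[v vA v0].
have y0 : v^t* != 0.
  apply: contra_neq v0 => h; rewrite -(trmxCK v) h.
  by apply/matrixP => i j; rewrite !mxE rmorph0.
have [a [ay ya]] := exists_unit_multiple y0.
exists (a%:C%C *: (v^t*)) => //.
have e : qform A (v^t*) = nu * qform 1%:M (v^t*).
  by rewrite /qform trmxCK mulmx1 vA -scalemxAl mxE.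
rewrite ya rmorphM fmorphV /= -(qform_real _ hA) e (qform_real _ (adjmx1 _ _)) mulfK //.
by rewrite fmorph_eq0 gt_eqF // rform1_gt0.
Qed.

(** Diagonalize A = U^* D U with [U] unitary. The rows of [U] are row eigenvectors, so [m] bounds
    every diagonal entry, and the forms are compared term by term in the coordinates of U x. *)
Lemma rform_ge_eigenvalue (m : K) x :
    (forall nu, eigenvalue A nu -> m%:C%C <= nu) ->
  m * rform 1%:M x <= rform A x.
Proof.
move=> hm; set U := spectralmx A; set d := spectral_diag A.
have Uu : U \is unitarymx by exact: spectral_unitarymx.
have Uunit : U \in unitmx by exact: spectral_unit.
have AE : A = invmx U *m diag_mx d *m U.
  apply/orthomx_spectralP/hermitian_normalmx/is_hermitianmxP.
  by rewrite expr0 scale1r hA.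
have dge k : m%:C%C <= d 0 k.
  apply: hm; apply/eigenvalueP; exists (row k U).
    by rewrite -row_mul AE !mulmxA mulmxV // mul1mx; apply/rowP => j; rewrite mul_diag_mx !mxE.
  apply/eqP => rk0; have /matrixP/(_ 0 k) : row k (U *m invmx U) = 0.
    by rewrite row_mul rk0 mul0mx.
  by rewrite mulmxV // !mxE eqxx => /eqP; rewrite oner_eq0.
have -> : rform 1%:M x = rform 1%:M (U *m x).
  rewrite /rform /qform adjmxM !mulmx1 -!mulmxA; congr (complex.Re ((_ *m _) 0 0)).
  by rewrite mulmxA -invmx_unitary // mulVmx // mul1mx.
have -> : rform A x = rform (diag_mx d) (U *m x).
  by rewrite {1}AE invmx_unitary // /rform /qform adjmxM !mulmxA.
rewrite rform1E mulr_sumr /rform /qform -mulmxA mul_diag_mx mxE.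
rewrite (_ : complex.Re _ = \sum_(k < n)
    complex.Re ((U *m x)^t* 0 k * (d 0 k * (U *m x) k 0))); last first.
  rewrite (eq_bigr (fun k => (U *m x)^t* 0 k * (d 0 k * (U *m x) k 0))).
    by elim/big_rec2: _ => //= k b c _ <-; rewrite ReD.
  by move=> k _; rewrite [X in _ * X]mxE.
apply: ler_sum => k _; rewrite normc2E; set w := (U *m x).
have -> : w^t* 0 k = conjc (w k 0) by rewrite !mxE.
(* The order of [K[i]] also yields that the diagonal entry has imaginary part 0. *)
move: (dge k); rewrite lecE; case: (d 0 k) (w k 0) => d1 d2 [a b] /=.
by move=> /andP[/eqP-> h]; nra.
Qed.

(** If x is a minimizer with value m, then A - m I is positive semidefinite and its form vanishes at
    x, which forces (A - m I) x = 0. Conversely, mu is the value of the form at x, and the spectral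
    bound applies. *)
Lemma rform_min_smallest_eigenvalue x : enorm x = 1 ->
  (forall y, enorm y = 1 -> rform A x <= rform A y) <->
  exists mu, smallest_eigenvalue A mu /\ A *m x = mu *: x.
Proof.
move=> /enorm_eq1 x1; split; last first.
  move=> [mu [[mue mumin] Axmu]].
  have muE : mu = (rform A x)%:C%C.
        rewrite -(qform_real _ hA) /qform -mulmxA Axmu -scalemxAr mxE.
    move: (qform_real x (adjmx1 _ _)); rewrite /qform mulmx1 => ->.
    by rewrite x1 rmorph1 mulr1.
  move=> y /enorm_eq1 y1; have := @rform_ge_eigenvalue (rform A x) y.
  by rewrite y1 mulr1; apply=> nu /mumin; rewrite muE.
move=> hmin; set m := rform A x.
have hge y : m * rform 1%:M y <= rform A y.
  have [->|y0] := eqVneq y 0.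
    by rewrite /rform /qform !mulmx0 !mxE /= mulr0.
  have [a [ay ya]] := exists_unit_multiple y0.
  by rewrite -ler_pdivlMr ?rform1_gt0 // -ya; exact: hmin.
pose M := A + (- m)%:C%C *: 1%:M.
have hM : M^t* = M.
  by rewrite adjmxD adjmxZ adjmx_scalar hA rmorph1 conjc_real.
have rM y : rform M y = rform A y - m * rform 1%:M y.
  by rewrite rformDl rformZl mulNr.
have Mx : M *m x = 0.
  apply/eqP/negPn/negP => /rform1_gt0.
  (* Moving from x in the direction M x, the form of [M] has linear coefficient 2 ||M x||^2, which
     must vanish since the form is nonnegative and starts at 0. *)
  set y := M *m x; set s := rform _ y => s0.
  have sE : complex.Re (sform M x y) = s.
    by rewrite /s /rform /qform /sform /y adjmxM hM !mulmx1.
  have Mge z : 0 <= rform M z by rewrite rM subr_ge0.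
  suff s_eq0 : s = 0 by move: s0; rewrite s_eq0 ltxx.
  apply: (quadratic_ge0 (Mge y)) => t.
  have := Mge (x + t%:C%C *: y).
  by rewrite rformDr // sE rM x1 mulr1 subrr add0r.
have Ax : A *m x = m%:C%C *: x.
  move/eqP: Mx; rewrite mulmxDl -scalemxAl mul1mx rmorphN scaleNr subr_eq0.
  by move=> /eqP.
exists m%:C%C; split=> //; split.
  apply/eigenvalueP; exists (x^t*).
    by rewrite -{1}hA -adjmxM Ax adjmxZ conjc_real.
  apply/eqP => /(congr1 (fun v => v *m x)); rewrite mul0mx => /matrixP/(_ 0 0).
  move/(congr1 (@complex.Re K)); rewrite -[x^t*]mulmx1 -/(qform _ _) -/(rform _ _) x1.
  by rewrite mxE /= => /eqP; rewrite oner_eq0.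
by move=> nu /eigenvalue_rform[y y1 ->]; rewrite lecR; exact: hmin.
Qed.

End RayleighQuotient.

(** * Directional derivatives and the gradient of h *)

Lemma derive_line (K : realType) (V : normedModType K) (f : V -> K) (z v : V) :
  'D_v f z = 'D_1 (fun t : K => f (t *: v + z)) 0.
Proof.
rewrite /derive; do 2 f_equal; apply/funext => h /=.
by rewrite !addr0 scale0r add0r [h *: 1]mulr1.
Qed.

Lemma derive_hfun (K : realType) (z v : 'cV[K]_3) : z 1 0 != 0 ->
  'D_v (@hfun K) z = 2 * (z 0 0 / z 1 0) / z 1 0 *
    (v 0 0 - z 0 0 / z 1 0 * v 1 0) + v 2 0.
Proof.
move=> z1; rewrite derive_line.
pose aff i : K -> K := v i 0 *: id + cst (z i 0).
have daff i : is_derive (0 : K) (1 : K) (aff i) (v i 0).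
  by apply: is_derive_eq; rewrite addr0 [_ *: 1]mulr1.
have affE i t : aff i t = v i 0 * t + z i 0 by [].
have -> : (fun t : K => hfun (t *: v + z)) =
    ((aff 0 * (fun t => (aff 1 t)^-1)) ^+ 2 + aff 2).
  by apply/funext => t; rewrite /hfun !mxE !(mulrC t).
have a1 : aff 1 0 != 0 by rewrite affE mulr0 add0r.
have dV := is_deriveV a1 (daff 1).
rewrite (derive_val (is_derive := is_deriveD (is_deriveX 2 (is_deriveM (daff 0) dV)) (daff 2))).
by rewrite expr1 mulrfctE !affE !mulr0 !add0r /GRing.scale /=; field.
Qed.

(** Factored so that at w = rho y the bracket is the form of R^2 - c R, c = z_1 / z_2; at w = z the
    bracket is 0 and z_3 remains. *)
Lemma inner_gradient_hfun (K : realType) (z w : 'cV[K]_3) : z 1 0 != 0 ->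
  inner (gradient (@hfun K) z) w = 2 * (z 0 0 / z 1 0) / z 1 0 *
    (w 0 0 - z 0 0 / z 1 0 * w 1 0) + w 2 0.
Proof.
move=> z1; rewrite /inner mxE !big_ord_recl big_ord0 !mxE !derive_hfun // !mxE /=.
have -> : lift ord0 (lift ord0 ord0) = 2 :> 'I_3 by exact: val_inj.
have -> : lift ord0 ord0 = 1 :> 'I_3 by exact: val_inj.
by field.
Qed.

(** * One-sided limits and the second-order decrease of h *)

Lemma cvg_mx (K : realType) (m n : nat) (T : Type) (F : set_system T) :
  Filter F -> forall (f : T -> 'M[K]_(m, n)) (z : 'M[K]_(m, n)),
  (forall i j, f t i j @[t --> F] --> z i j) -> f t @[t --> F] --> z.
Proof.
move=> FF f z fz; apply/cvg_ballP => e e0.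
suff h : \forall t \near F, forall i j, ball (z i j) e (f t i j).
  by apply: filterS h => t h; split.
by apply: filter_forall => i; apply: filter_forall => j; move/cvg_ballP: (fz i j); exact.
Qed.

Lemma cvg_quadratic (K : realType) (p q r : K) :
  (p + t * q + t ^+ 2 * r) @[t --> (0 : K)^'+] --> p.
Proof.
apply: cvg_at_right_filter.
have {2}-> : p = p + 0 * q + 0 ^+ 2 * r by rewrite expr0n !mul0r !addr0.
apply: cvgD; [apply: cvgD; [exact: cvg_cst|]|]; apply: cvgM;
  by [exact: cvg_cst|exact: cvg_id|exact: exprn_continuous].
Qed.

(** Multiplying al by i times its conjugate gives a purely imaginary number; the sign of u is still
    free and settles the second condition. *)
Lemma exists_rotation (K : realType) (al be : K[i]) : exists2 u : K[i], u != 0 &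
  complex.Re (u * al) = 0 /\ complex.Re (u * be) <= 0.
Proof.
have [u0 u0N0 hu0] : exists2 u : K[i], u != 0 & complex.Re (u * al) = 0.
  have [->|al0] := eqVneq al 0.
    by exists 1; rewrite ?oner_eq0 ?mulr0.
  exists ('i%C * conjc al).
    rewrite mulf_neq0 ?conjc_eq0 //.
    by rewrite eq_complex /= eqxx oner_eq0.
  by case: al {al0} => a b /=; ring.
have [h|h] := leP (complex.Re (u0 * be)) 0; first by exists u0.
exists (- u0); rewrite ?oppr_eq0 // !mulNr.
have ReN (w : K[i]) : complex.Re (- w) = - complex.Re w by case: w.
by rewrite !ReN hu0 oppr0 oppr_le0 (ltW h).
Qed.

(** As t tends to 0+, the two terms 2 c a / s cancel in the limit and leave b < 0. *)
Lemma near_quotient_lt0 (K : realType) (N S : K -> K) (s a b c : K) :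
    N t @[t --> (0 : K)^'+] --> (1 : K) -> S t @[t --> (0 : K)^'+] --> s ->
    s != 0 -> b < 0 ->
  \forall t \near (0 : K)^'+, [/\ 0 < t, 0 < N t, S t != 0 &
    2 * c * a / S t + t ^+ 2 * (a / S t) ^+ 2 + (b - 2 * c * a / s) / N t < 0].
Proof.
move=> cvgN cvgS s0 b0.
pose psi t := 2 * c * a / S t + t ^+ 2 * (a / S t) ^+ 2 +
  (b - 2 * c * a / s) / N t.
have cvgSV : (S t)^-1 @[t --> (0 : K)^'+] --> s^-1 by exact: cvgV.
have cvgNV : (N t)^-1 @[t --> (0 : K)^'+] --> (1 : K).
  by rewrite -[X in _ --> X]invr1; apply: cvgV => //; rewrite oner_eq0.
have cvgt : t @[t --> (0 : K)^'+] --> (0 : K).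
  by apply: cvg_at_right_filter; exact: cvg_id.
have cvgaS : a / S t @[t --> (0 : K)^'+] --> a / s.
  by apply: cvgM => //; exact: cvg_cst.
have cvgpsi : psi t @[t --> (0 : K)^'+] --> b.
  have -> : b = 2 * c * a / s + 0 * 0 * (a / s * (a / s)) +
      (b - 2 * c * a / s) * 1 by rewrite !mul0r addr0 mulr1 addrC subrK.
  apply: cvgD; last by apply: cvgM => //; exact: cvg_cst.
  apply: cvgD; first by apply: cvgM => //; exact: cvg_cst.
  by apply: cvgM; apply: cvgM.
have psi_lt0 : \forall t \near (0 : K)^'+, psi t < 0 by exact: (cvgr_lt _ cvgpsi).
have N_gt0 : \forall t \near (0 : K)^'+, 0 < N t.
  by apply: (cvgr_gt _ cvgN); exact: ltr01.
have S_neq0 : \forall t \near (0 : K)^'+, S t != 0 by exact: (cvgr_neq0 _ cvgS).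
have t_gt0 := nbhs_right_gt (0 : K).
by near=> t; split; near: t.
Unshelve. all: by end_near. Qed.

(** The squared ratio is that of c + t^2 a / S, because N cancels. Subtracting c^2 + z3 leaves t^2
    times the negative quantity of the last hypothesis, plus 2 t beta / N <= 0. *)
Lemma quotient_drop (K : realFieldType) (t N S s z3 a b c beta : K) :
    0 < t -> 0 < N -> S != 0 -> s != 0 -> beta <= 0 ->
    2 * c * a / S + t ^+ 2 * (a / S) ^+ 2 + (b - 2 * c * a / s) / N < 0 ->
  ((c * S + t ^+ 2 * a) / N / (S / N)) ^+ 2 +
  (z3 * N - 2 * c / s * (t ^+ 2 * a) + (t * (2 * beta) + t ^+ 2 * b)) / N <
  c ^+ 2 + z3.
Proof.
move=> t0 N0 S0 s0 be0 psi; rewrite -subr_lt0.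
have N_neq0 : N != 0 by rewrite gt_eqF.
rewrite [X in X < 0](_ : _ = t ^+ 2 * (2 * c * a / S + t ^+ 2 * (a / S) ^+ 2 +
    (b - 2 * c * a / s) / N) + 2 * t * beta / N).
  rewrite ltr_wnDr ?pmulr_rlt0 ?exprn_gt0 // pmulr_lle0 ?invr_gt0 //.
  by rewrite pmulr_rle0 // mulr_gt0.
by field; rewrite N_neq0 S0 s0.
Qed.

(** * The second-order condition at a local minimizer *)

Section LocalMinimizer.
Variables (K : realType) (n : nat) (R P : 'M[K[i]]_n).
Hypotheses (hR : R^t* = R) (hP : P^t* = P).
Implicit Types (x y : 'cV[K[i]]_n).

Lemma rhoE x : rho R P x =
  \col_(k < 3) [:: rform (R *m R) x; rform R x; rform P x]`_k.
Proof. by []. Qed.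

(** The right side is y^*H(x)y, so this is H(x) - z_3 I >= 0 in homogeneous form; y is not
    normalized. *)
Lemma local_minimizer_rform_ge x (z : 'cV[K]_3) (c := z 0 0 / z 1 0) y :
    z = rho R P x -> enorm x = 1 -> z 1 0 != 0 ->
    local_minimizer (@hfun K) (joint_range R P) z ->
  z 2 0 * rform 1%:M y <=
    2 * c / z 1 0 * (rform (R *m R) y - c * rform R y) + rform P y.
Proof.
move=> zE x1 z1 [_ zmin].
pose A := R *m R + (- c)%:C%C *: R.
pose B := (2 * c / z 1 0)%:C%C *: A + P + (- z 2 0)%:C%C *: 1%:M.
have hRR : (R *m R)^t* = R *m R by rewrite adjmxM hR.
have hA : A^t* = A by rewrite adjmxD adjmxZ hRR hR conjc_real.
have combE k m (M : 'M[K[i]]_n) v : rform (k%:C%C *: M + P + m%:C%C *: 1%:M) v =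
    k * rform M v + rform P v + m * rform 1%:M v.
  by rewrite !rformDl !rformZl.
have hB : B^t* = B.
  by rewrite /B; move: (A) hA => M hM; rewrite !adjmxD !adjmxZ hM hP (adjmx1 K n) !conjc_real.
have rA v : rform A v = rform (R *m R) v - c * rform R v.
  by rewrite rformDl rformZl mulNr.
have rB v : rform B v =
    2 * c / z 1 0 * rform A v + rform P v - z 2 0 * rform 1%:M v.
  by rewrite combE mulNr.
rewrite -rA -subr_ge0 -rB leNgt; apply/negP => By0.
have [u u0 [uA uB]] := exists_rotation (sform A x y) (sform B x y).
(* The factor [u] multiplies the cross terms with x, but scales the form of [B] by |u|^2 > 0, so
   negativity survives. *)
pose y' := u *: y.
have By'0 : rform B y' < 0 by rewrite rformZ pmulr_rlt0 ?conjcM_gt0.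
rewrite -!sformZr -/y' in uA uB.
have z0E : z 0 0 = rform (R *m R) x by rewrite zE rhoE mxE.
have z1E : z 1 0 = rform R x by rewrite zE rhoE mxE.
have z2E : z 2 0 = rform P x by rewrite zE rhoE mxE.
have cz1 : c * z 1 0 = z 0 0 by rewrite /c divfK.
have x1' : rform 1%:M x = 1 by exact/enorm_eq1.
have Ax : rform A x = 0 by rewrite rA -z0E -z1E cz1 subrr.
have Bx : rform B x = 0 by rewrite rB Ax x1' -z2E mulr1 mulr0 add0r subrr.
have [a aE] : exists a, a = rform A y' by exists (rform A y').
have [b bE] : exists b, b = rform B y' by exists (rform B y').
have b0 : b < 0 by rewrite bE.
pose v t := x + t%:C%C *: y'.
have cvg_v M : M^t* = M -> rform M (v t) @[t --> (0 : K)^'+] --> rform M x.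
  move=> hM; under eq_fun do rewrite rformDr //; exact: cvg_quadratic.
pose N t := rform 1%:M (v t); pose S t := rform R (v t).
have cvgN : N t @[t --> (0 : K)^'+] --> (1 : K).
  by rewrite -x1'; apply: cvg_v; exact: adjmx1.
have cvgS : S t @[t --> (0 : K)^'+] --> z 1 0 by rewrite z1E; exact: cvg_v.
(* The image under rho of [v t] normalized, written with quotients so as to be defined for every t;
   it is shown to lie in the joint range only where N t > 0. *)
pose w t : 'cV[K]_3 := \col_(k < 3)
  [:: rform (R *m R) (v t) / N t; rform R (v t) / N t; rform P (v t) / N t]`_k.
have cvgw : w t @[t --> (0 : K)^'+] --> z.
  have cvg_div M : M^t* = M ->
      rform M (v t) / N t @[t --> (0 : K)^'+] --> rform M x.
    move=> hM; rewrite -[X in _ --> X]divr1; apply: cvgM; first exact: cvg_v.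
    by apply: cvgV => //; rewrite oner_eq0.
  apply: cvg_mx => i j; rewrite zE rhoE mxE; under eq_fun do rewrite mxE.
  by case: i => -[|[|[|//]]] ? /=; exact: cvg_div.
have near_lt0 := near_quotient_lt0 a c cvgN cvgS z1 b0.
have near_min : \forall t \near (0 : K)^'+, joint_range R P (w t) ->
    hfun z <= hfun (w t) by exact: (cvgw _ zmin).
have [t [[t0 Nt0 St0 psit] hmin]] := filter_ex (filterI near_lt0 near_min).
have vt0 : v t != 0.
  by apply: contraTneq Nt0 => vt; rewrite /N vt /rform /qform !mulmx0 mxE /= ltxx.
have /hmin : joint_range R P (w t).
  have [k [k1 kE]] := exists_unit_multiple vt0.
  exists (k%:C%C *: v t); split=> //.
  by apply/matrixP => i j; rewrite rhoE !mxE !kE.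
(* The choice of [u] removes the linear term, so z_1 / z_2 varies only to order t^2. *)
have At : rform (R *m R) (v t) = c * S t + t ^+ 2 * a.
  have : rform A (v t) = t ^+ 2 * a by rewrite rformDr // Ax uA aE !mulr0 !add0r.
  by rewrite rA => <-; rewrite addrC subrK.
(* Solve the definition of [B] for [P]; the linear term left over has the sign given by [uB]. *)
have Pt : rform P (v t) = z 2 0 * N t - 2 * c / z 1 0 * (t ^+ 2 * a) +
    (t * (2 * complex.Re (sform B x y')) + t ^+ 2 * b).
  have : rform B (v t) = t * (2 * complex.Re (sform B x y')) + t ^+ 2 * b.
    by rewrite rformDr // Bx bE add0r.
  move=> <-; rewrite rB rA -/(S t) -/(N t) At [c * _ + _]addrC addrK.
  by rewrite [in RHS]addrC addrA subrK addrAC subrr add0r.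
have : hfun (w t) < hfun z.
  rewrite {1}/hfun !mxE /= -/(S t) At Pt.
  exact: (quotient_drop _ t0 Nt0 St0 z1 uB psit).
by rewrite ltNge => /negP.
Qed.

End LocalMinimizer.

(** * The matrix H(x) and the linearization of h *)

Lemma adjmx_Pmx (K : realType) (n : nat) (J Q : 'M[K[i]]_n) (omega : K) :
  Q^t* = Q -> (Pmx J Q omega)^t* = Pmx J Q omega.
Proof.
move=> hQ; rewrite /Pmx; set M := _ - _.
have hV : (invmx Q)^t* = invmx Q by rewrite trmx_inv map_invmx hQ.
by rewrite !adjmxM hV trmxCK !mulmxA.
Qed.

Section GradientForm.
Variables (K : realType) (n : nat) (R P : 'M[K[i]]_n).
Hypotheses (hR : R^t* = R) (hP : P^t* = P).
Implicit Types (x y : 'cV[K[i]]_n).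

(** Both coefficients are real and share the factor 2 c / x^*Rx, which brings out the matrix R^2 - c
    R. *)
Lemma HmxE x : let c := rform (R *m R) x / rform R x in rform R x != 0 ->
  Hmx R P x = (2 * c / rform R x)%:C%C *: (R *m R + (- c)%:C%C *: R) + P.
Proof.
move=> c Rx; have hRR : (R *m R)^t* = R *m R by rewrite adjmxM hR.
rewrite /Hmx !qform_real //; move: (rform (R *m R) x) (rform R x) Rx @c => p q q0 c.
have -> : 2 * (p%:C / q%:C ^+ 2)%C = (2 * c / q)%:C%C.
  rewrite -(rmorph_nat (real_complex K)) -!rmorphXn -fmorphV -!rmorphM.
  by congr (_%:C)%C; rewrite /c; field.
rewrite -scaleNr; have -> : - (2 * (p%:C ^+ 2 / q%:C ^+ 3)%C) = (2 * c / q * - c)%:C%C.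
  rewrite -(rmorph_nat (real_complex K)) -!rmorphXn -fmorphV -!rmorphM -rmorphN.
  by congr (_%:C)%C; rewrite /c; field.
by rewrite scalerDr scalerA -rmorphM.
Qed.

Lemma adjmx_Hmx x : rform R x != 0 -> (Hmx R P x)^t* = Hmx R P x.
Proof.
move=> /HmxE ->; have hRR : (R *m R)^t* = R *m R by rewrite adjmxM hR.
by rewrite !(adjmxD, adjmxZ) hRR hR hP !conjc_real.
Qed.

(** The coefficients of R^2, R and P in H(x) are the partial derivatives of h at rho x. Hence
    minimizing the linearization over the joint range is minimizing the form of H(x) over unit
    vectors. *)
Lemma rform_Hmx x y : rform R x != 0 ->
  rform (Hmx R P x) y = inner (gradient (@hfun K) (rho R P x)) (rho R P y).
Proof.
move=> Rx; rewrite inner_gradient_hfun; last by rewrite rhoE mxE.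
by rewrite (HmxE Rx) rformDl rformZl rformDl rformZl mulNr !rhoE !mxE.
Qed.

End GradientForm.

Theorem theorem4p2 (K : realType) (n : nat) (J R Q : 'M[K[i]]_n) (omega : K)
    (hJ : J^t* = - J) (hR : psdmx R) (hQ : pdmx Q) :
  let P := Pmx J Q omega in
  let W := joint_range R P in
  forall z : 'cV[K]_3, W z -> hdiff z ->
    let g := gradient (@hfun K) z in
    let star := is_min [set inner g w | w in W] (inner g z) in
    (local_minimizer (@hfun K) W z -> star) /\
    (star <-> exists x : 'cV[K[i]]_n,
       [/\ z = rho R P x, enorm x = 1 &
           exists mu : K[i], smallest_eigenvalue (Hmx R P x) mu /\
                             Hmx R P x *m x = mu *: x]).
Proof.
move=> P W z Wz hz g star; have z1 : z 1 0 != 0 by [].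
have {hJ} hP : P^t* = P by apply: adjmx_Pmx; case: hQ.
have {hQ} [{}hR _] := hR.
(* This holds for every x representing z, although H(x) is written in terms of x. *)
have starP x : z = rho R P x ->
    star <-> forall y, enorm y = 1 -> rform (Hmx R P x) x <= rform (Hmx R P x) y.
  move=> zE; have Rx : rform R x != 0 by move: z1; rewrite zE rhoE mxE.
  rewrite /star /g zE; split=> [[_ gmin] y y1|gmin].
    by rewrite !rform_Hmx //; apply: gmin; exists (rho R P y) => //; exists y.
  split; first by exists z => //; rewrite zE.
  by move=> _ [_ [y [y1 ->]] <-]; rewrite -!rform_Hmx //; exact: gmin.
split=> [zmin|].
  have [x [x1 zE]] := Wz; apply/(starP x zE) => y /enorm_eq1 y1.
  have Rx : rform R x != 0 by move: z1; rewrite zE rhoE mxE.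
  have := local_minimizer_rform_ge hR hP y zE x1 z1 zmin.
  (* The linearized objective takes the value z_3 at z itself, which is the left side of the
     second-order inequality for unit y. *)
  rewrite y1 mulr1 !rform_Hmx // -zE !inner_gradient_hfun // divfK // subrr mulr0 add0r.
  by rewrite [rho R P y]rhoE !mxE.
split=> [hstar|[x [zE x1 hx]]].
  (* Any unit vector representing z serves as the eigenvector. *)
  have [x [x1 zE]] := Wz; exists x; split=> //.
  apply/rform_min_smallest_eigenvalue => //; last exact/starP.
  by apply: adjmx_Hmx => //; move: z1; rewrite zE rhoE mxE.
apply/(starP x zE)/rform_min_smallest_eigenvalue => //.
by apply: adjmx_Hmx => //; move: z1; rewrite zE rhoE mxE.
Qed.
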